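(* Let $(M,g)$ be a tangential hypersurface, with unit normal vector field $N$, of a locally product-like statistical manifold $(\widetilde{M},\widetilde{g},\widetilde{\nabla},F)$. Then for all $X,Y\in\Gamma(TM)$: $$(\nabla_{X}\varphi)Y=g(A^{\ast}_{N}X,Y)\xi+\eta^{\ast}(Y)A_{N}X,$$ $$(\nabla^{\ast}_{X}\varphi^{\ast})Y=g(A_{N}X,Y)\xi^{\ast}+\eta(Y)A^{\ast}_{N}X.$$
   Context: A statistical manifold $(\widetilde{M},\widetilde{g},\widetilde{\nabla})$ is a Riemannian manifold with a torsion-free affine connection $\widetilde{\nabla}$ such that $\widetilde{\nabla}\widetilde{g}$ is totally symmetric. The dual connection $\widetilde{\nabla}^{\ast}$ is defined by $Z\widetilde{g}(X,Y)=\widetilde{g}(X,\widetilde{\nabla}^{\ast}_{Z}Y)+\widetilde{g}(\widetilde{\nabla}_{Z}X,Y)$; it is also torsion-free. A locally product-like statistical manifold $(\widetilde{M},\widetilde{g},\widetilde{\nabla},F)$ is a statistical manifold with a $(1,1)$-tensor field $F$ satisfying $F^{2}=I$ and $\widetilde{\nabla}F=0$, together with the $(1,1)$-tensor field $F^{\ast}$ satisfying $\widetilde{g}(FX,Y)=\widetilde{g}(X,F^{\ast}Y)$. A hypersurface $(M,g)$ (induced metric $g$, unit normal $N$) is tangential if $FN$ and $F^{\ast}N$ are tangent to $M$. Then put $\xi=FN$, $\xi^{\ast}=F^{\ast}N$, and for $X\in\Gamma(TM)$ write $FX=\varphi X+\eta^{\ast}(X)N$, $F^{\ast}X=\varphi^{\ast}X+\eta(X)N$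 with $\varphi X,\varphi^{\ast}X$ tangent to $M$ and $\eta,\eta^{\ast}$ $1$-forms on $M$ (so $\eta(X)=g(X,\xi)$, $\eta^{\ast}(X)=g(X,\xi^{\ast})$). The Gauss and Weingarten formulas, for $X,Y\in\Gamma(TM)$, are $$\widetilde{\nabla}_{X}Y=\nabla_{X}Y+g(A^{\ast}_{N}X,Y)N,\quad \widetilde{\nabla}_{X}N=-A_{N}X+\kappa(X)N,$$ $$\widetilde{\nabla}^{\ast}_{X}Y=\nabla^{\ast}_{X}Y+g(A_{N}X,Y)N,\quad \widetilde{\nabla}^{\ast}_{X}N=-A^{\ast}_{N}X-\kappa(X)N,$$ which define the induced connections $\nabla,\nabla^{\ast}$ on $M$, the shape operators $A_{N},A^{\ast}_{N}$ and the $1$-form $\kappa$ on $M$. As usual, $(\nabla_{X}\varphi)Y=\nabla_{X}(\varphi Y)-\varphi(\nabla_{X}Y)$ and similarly for $\nabla^{\ast}\varphi^{\ast}$. *)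

(* Defs.v *)
From HB Require Import structures.
From mathcomp Require Import all_boot all_order all_algebra.
From mathcomp Require Import all_classical all_reals all_analysis.

Set Implicit Arguments.
Unset Strict Implicit.
Unset Printing Implicit Defensive.

Import Order.TTheory GRing.Theory Num.Theory.
Import numFieldNormedType.Exports.

Local Open Scope classical_set_scope.
Local Open Scope ring_scope.

(* -------------------------------------------------------------------------- *)
(** ** C^oo maps between normed spaces *)

Fixpoint Ck (R : realType) (V W : normedModType R) (k : nat) (U : set V)
    (f : V -> W) : Prop :=
  match k with
  | 0%N => forall x, U x -> {for x, continuous f}
  | k'.+1 => (forall x, U x -> differentiable f x) /\
             (forall v : V, Ck k' U (fun x => 'D_v f x))
  end.

(* C^oo on a whole neighbourhood of [x], independent of the order [k] *)
Definition smooth_at (R : realType) (V W : normedModType R) (f : V -> W)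
    (x : V) : Prop :=
  exists U : set V, [/\ open U, U x & forall k, Ck k U f].

(* -------------------------------------------------------------------------- *)
(** ** Manifolds *)

(* The atlas is indexed by the points of the manifold: [chart p] is a chosen
   chart around [p], with domain [dom p], image [img p] and inverse
   [chart_inv p] (values outside [dom p], [img p] are irrelevant).  Every atlas
   contains, up to repetition, such a subatlas, and it determines the smooth
   structure. *)
Record manifold (R : realType) (n : nat) := Manifold {
  carrier :> topologicalType;
  chart : carrier -> carrier -> 'rV[R]_n;
  chart_inv : carrier -> 'rV[R]_n -> carrier;
  dom : carrier -> set carrier;
  img : carrier -> set 'rV[R]_n;
  carrier_hausdorff : hausdorff_space carrier;
  carrier_second_countable : @second_countable carrier;
  dom_open : forall p, open (dom p);
  img_open : forall p, open (img p);
  dom_self : forall p, dom p p;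
  chart_img : forall p x, dom p x -> img p (chart p x);
  chart_inv_dom : forall p y, img p y -> dom p (chart_inv p y);
  chartK : forall p x, dom p x -> chart_inv p (chart p x) = x;
  chart_invK : forall p y, img p y -> chart p (chart_inv p y) = y;
  chart_continuous : forall p x, dom p x -> {for x, continuous (chart p)};
  chart_inv_continuous :
    forall p y, img p y -> {for y, continuous (chart_inv p)};
  transition_smooth : forall p q x, dom p x -> dom q x ->
    smooth_at (fun y => chart q (chart_inv p y)) (chart p x)
}.

(* The tangent space T_pM is 'rV[R]_n: a vector is given by its components in
   the chart [chart p].  Hence the identification of T_pM with 'rV[R]_n changes
   with p, and comparing vectors at different points goes through [coord]. *)

Section Calculus.
Variables (R : realType) (n : nat) (M : manifold R n).

(* components in [chart p] of the vector [v] of T_xM, for x in [dom p] *)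
Definition coord (p x : M) (v : 'rV[R]_n) : 'rV[R]_n :=
  'd (fun y => chart p (chart_inv x y)) (chart x x) v.

(* i-th coordinate vector field of [chart p], on [dom p] *)
Definition coord_field (p : M) (i : 'I_n) (x : M) : 'rV[R]_n :=
  'd (fun y => chart x (chart_inv p y)) (chart p x) (delta_mx 0 i).

Definition smooth_fun_at (f : M -> R) (p : M) : Prop :=
  smooth_at (fun y => f (chart_inv p y)) (chart p p).

(* the derivative v(f) of [f] along [v] in T_pM *)
Definition dirder (f : M -> R) (p : M) (v : 'rV[R]_n) : R :=
  'd (fun y => f (chart_inv p y)) (chart p p) v.

End Calculus.

Section Along.
Variables (R : realType) (n m : nat) (M : manifold R n) (M' : manifold R m).
Variable f : M -> M'.

Definition smooth_map : Prop :=
  continuous f /\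
  forall p, smooth_at (fun y => chart (f p) (f (chart_inv p y))) (chart p p).

(* the differential T_pM -> T_(f p)M' *)
Definition dmap (p : M) (v : 'rV[R]_n) : 'rV[R]_m :=
  'd (fun y => chart (f p) (f (chart_inv p y))) (chart p p) v.

Definition immersion : Prop := smooth_map /\ forall p, injective (dmap p).

(* A vector field along [f] is V with V x in T_(f x)M'; [local_rep V p] is its
   expression in the charts [chart p] and [chart (f p)]. *)
Definition local_rep (V : M -> 'rV[R]_m) (p : M) : 'rV[R]_n -> 'rV[R]_m :=
  fun y => coord (f p) (f (chart_inv p y)) (V (chart_inv p y)).

Definition smooth_along_at (V : M -> 'rV[R]_m) (p : M) : Prop :=
  smooth_at (local_rep V p) (chart p p).

Definition smooth_along (V : M -> 'rV[R]_m) : Prop :=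
  forall p, smooth_along_at V p.

End Along.

Section Tensors.
Variables (R : realType) (n : nat) (M : manifold R n).

Definition smooth_field_at (X : M -> 'rV[R]_n) (p : M) : Prop :=
  smooth_along_at (@idfun M) X p.

Definition smooth_field (X : M -> 'rV[R]_n) : Prop :=
  forall p, smooth_field_at X p.

Definition lie_bracket (X Y : M -> 'rV[R]_n) (p : M) : 'rV[R]_n :=
  'd (local_rep (@idfun M) Y p) (chart p p) (X p)
  - 'd (local_rep (@idfun M) X p) (chart p p) (Y p).

Definition one_form (eta : M -> 'rV[R]_n -> R) : Prop :=
  (forall p a v w, eta p (a *: v + w) = a * eta p v + eta p w) /\
  (forall p X, smooth_field_at X p ->
     smooth_fun_at (fun q => eta q (X q)) p).

Definition tensor11 (F : M -> 'rV[R]_n -> 'rV[R]_n) : Prop :=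
  (forall p a v w, F p (a *: v + w) = a *: F p v + F p w) /\
  (forall p X, smooth_field_at X p ->
     smooth_field_at (fun q => F q (X q)) p).

Record riemannian_metric (g : M -> 'rV[R]_n -> 'rV[R]_n -> R) : Prop := {
  metric_sym : forall p v w, g p v w = g p w v;
  metric_lin : forall p a u v w, g p (a *: u + v) w = a * g p u w + g p v w;
  metric_pos : forall p v, v != 0 -> 0 < g p v v;
  metric_smooth : forall p X Y, smooth_field_at X p -> smooth_field_at Y p ->
    smooth_fun_at (fun q => g q (X q) (Y q)) p
}.

(* [nabla p v Y] is the covariant derivative, in T_pM, of the vector field Y,
   smooth on a neighbourhood of p, along v in T_pM; the value is irrelevant
   when Y is not smooth near p.  As [conn_leibniz] covers all f smooth near p,
   in particular indicators of neighbourhoods of p, [nabla p v Y] depends only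
   on the germ of Y at p. *)
Record affine_connection
    (nabla : M -> 'rV[R]_n -> (M -> 'rV[R]_n) -> 'rV[R]_n) : Prop := {
  conn_lin : forall p a v w Y, smooth_field_at Y p ->
    nabla p (a *: v + w) Y = a *: nabla p v Y + nabla p w Y;
  conn_add : forall p v Y Z, smooth_field_at Y p -> smooth_field_at Z p ->
    nabla p v (fun q => Y q + Z q) = nabla p v Y + nabla p v Z;
  conn_leibniz : forall p v f Y, smooth_fun_at f p -> smooth_field_at Y p ->
    nabla p v (fun q => f q *: Y q) = dirder f p v *: Y p + f p *: nabla p v Y;
  conn_smooth : forall p X Y, smooth_field_at X p -> smooth_field_at Y p ->
    smooth_field_at (fun q => nabla q (X q) Y) p
}.

Definition torsion_free
    (nabla : M -> 'rV[R]_n -> (M -> 'rV[R]_n) -> 'rV[R]_n) : Prop :=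
  forall p X Y, smooth_field_at X p -> smooth_field_at Y p ->
    nabla p (X p) Y - nabla p (Y p) X = lie_bracket X Y p.

(* ((nabla_v F) Y)(p) *)
Definition cov_tensor11
    (nabla : M -> 'rV[R]_n -> (M -> 'rV[R]_n) -> 'rV[R]_n)
    (F : M -> 'rV[R]_n -> 'rV[R]_n) (p : M) (v : 'rV[R]_n)
    (Y : M -> 'rV[R]_n) : 'rV[R]_n :=
  nabla p v (fun q => F q (Y q)) - F p (nabla p v Y).

(* ((nabla_X g)(Y, Z))(p) *)
Definition cov_metric
    (nabla : M -> 'rV[R]_n -> (M -> 'rV[R]_n) -> 'rV[R]_n)
    (g : M -> 'rV[R]_n -> 'rV[R]_n -> R) (p : M)
    (X Y Z : M -> 'rV[R]_n) : R :=
  dirder (fun q => g q (Y q) (Z q)) p (X p)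
  - g p (nabla p (X p) Y) (Z p) - g p (Y p) (nabla p (X p) Z).

Record statistical_manifold (g : M -> 'rV[R]_n -> 'rV[R]_n -> R)
    (nabla : M -> 'rV[R]_n -> (M -> 'rV[R]_n) -> 'rV[R]_n) : Prop := {
  stat_metric : riemannian_metric g;
  stat_conn : affine_connection nabla;
  stat_torsion_free : torsion_free nabla;
  (* invariance under two transpositions generating the symmetric group *)
  stat_symmetric : forall p X Y Z,
    smooth_field_at X p -> smooth_field_at Y p -> smooth_field_at Z p ->
    cov_metric nabla g p X Y Z = cov_metric nabla g p Y X Z /\
    cov_metric nabla g p X Y Z = cov_metric nabla g p X Z Y
}.

Record dual_connection (g : M -> 'rV[R]_n -> 'rV[R]_n -> R)
    (nabla nablas : M -> 'rV[R]_n -> (M -> 'rV[R]_n) -> 'rV[R]_n) : Prop := {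
  dual_conn : affine_connection nablas;
  dual_formula : forall p v X Y, smooth_field_at X p -> smooth_field_at Y p ->
    dirder (fun q => g q (X q) (Y q)) p v =
      g p (X p) (nablas p v Y) + g p (nabla p v X) (Y p)
}.

Record locally_product_like_statistical_manifold
    (g : M -> 'rV[R]_n -> 'rV[R]_n -> R)
    (nabla : M -> 'rV[R]_n -> (M -> 'rV[R]_n) -> 'rV[R]_n)
    (F Fs : M -> 'rV[R]_n -> 'rV[R]_n) : Prop := {
  lpl_stat : statistical_manifold g nabla;
  lpl_F : tensor11 F;
  lpl_Fs : tensor11 Fs;
  lpl_invol : forall p v, F p (F p v) = v;
  lpl_parallel : forall p v Y, smooth_field_at Y p ->
    cov_tensor11 nabla F p v Y = 0;
  lpl_adjoint : forall p v w, g p (F p v) w = g p v (Fs p w)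
}.

End Tensors.

(* -------------------------------------------------------------------------- *)
(** ** Hypersurfaces *)

Section Hypersurface.
Variables (R : realType) (n m : nat) (M : manifold R n) (Mt : manifold R m).
Variable iota : M -> Mt.

(* Covariant derivative at p, along v in T_pM, of a vector field V along iota:
   writing V = \sum_i V^i (E_i \o iota) near p, with E_i the coordinate fields
   of [chart (iota p)], it is \sum_i v(V^i) E_i + V^i nabla_(diota v) E_i.  This
   is the meaning of nabla_v V for V tangent to the ambient manifold but defined
   on M only; for V = W \o iota it is nabla_(diota v) W. *)
Definition cov_along
    (nabla : Mt -> 'rV[R]_m -> (Mt -> 'rV[R]_m) -> 'rV[R]_m)
    (p : M) (v : 'rV[R]_n) (V : M -> 'rV[R]_m) : 'rV[R]_m :=
  'd (local_rep iota V p) (chart p p) v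
  + \sum_(i < m) V p 0 i
      *: nabla (iota p) (dmap iota p v) (coord_field (iota p) i).

Definition induced_metric (g : Mt -> 'rV[R]_m -> 'rV[R]_m -> R)
    (p : M) (v w : 'rV[R]_n) : R :=
  g (iota p) (dmap iota p v) (dmap iota p w).

Definition unit_normal (g : Mt -> 'rV[R]_m -> 'rV[R]_m -> R)
    (N : M -> 'rV[R]_m) : Prop :=
  [/\ smooth_along iota N,
      forall p, g (iota p) (N p) (N p) = 1
    & forall p v, g (iota p) (N p) (dmap iota p v) = 0].

(* F N and Fs N are tangent to M; this also introduces xi = F N, xis = Fs N and
   the decompositions F X = phi X + etas(X) N, Fs X = phis X + eta(X) N *)
Record tangential (F Fs : Mt -> 'rV[R]_m -> 'rV[R]_m) (N : M -> 'rV[R]_m)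
    (xi xis : M -> 'rV[R]_n) (phi phis : M -> 'rV[R]_n -> 'rV[R]_n)
    (eta etas : M -> 'rV[R]_n -> R) : Prop := {
  tang_xi : smooth_field xi;
  tang_xis : smooth_field xis;
  tang_phi : tensor11 phi;
  tang_phis : tensor11 phis;
  tang_eta : one_form eta;
  tang_etas : one_form etas;
  tang_FN : forall p, F (iota p) (N p) = dmap iota p (xi p);
  tang_FsN : forall p, Fs (iota p) (N p) = dmap iota p (xis p);
  tang_FX : forall p v, F (iota p) (dmap iota p v) =
    dmap iota p (phi p v) + etas p v *: N p;
  tang_FsX : forall p v, Fs (iota p) (dmap iota p v) =
    dmap iota p (phis p v) + eta p v *: N p
}.

Record gauss_weingarten (g : Mt -> 'rV[R]_m -> 'rV[R]_m -> R)
    (nablat nablats : Mt -> 'rV[R]_m -> (Mt -> 'rV[R]_m) -> 'rV[R]_m)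
    (N : M -> 'rV[R]_m)
    (nabla nablas : M -> 'rV[R]_n -> (M -> 'rV[R]_n) -> 'rV[R]_n)
    (A As : M -> 'rV[R]_n -> 'rV[R]_n) (kappa : M -> 'rV[R]_n -> R)
    : Prop := {
  gw_nabla : affine_connection nabla;
  gw_nablas : affine_connection nablas;
  gw_A : tensor11 A;
  gw_As : tensor11 As;
  gw_kappa : one_form kappa;
  gw_gauss : forall p v Y, smooth_field_at Y p ->
    cov_along nablat p v (fun q => dmap iota q (Y q)) =
      dmap iota p (nabla p v Y)
      + induced_metric g p (As p v) (Y p) *: N p;
  gw_weingarten : forall p v,
    cov_along nablat p v N = - dmap iota p (A p v) + kappa p v *: N p;
  gw_gauss_dual : forall p v Y, smooth_field_at Y p ->
    cov_along nablats p v (fun q => dmap iota q (Y q)) =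
      dmap iota p (nablas p v Y)
      + induced_metric g p (A p v) (Y p) *: N p;
  gw_weingarten_dual : forall p v,
    cov_along nablats p v N = - dmap iota p (As p v) - kappa p v *: N p
}.

End Hypersurface.

(* Main.v *)
From HB Require Import structures.
Require Import Defs.
From mathcomp Require Import all_boot all_order all_algebra.
From mathcomp Require Import all_classical all_reals all_analysis.
From mathcomp Require Import lra.
Import Order.TTheory GRing.Theory Num.Theory.
Import numFieldNormedType.Exports.
Local Open Scope classical_set_scope.
Local Open Scope ring_scope.

(* Parallelism of F passes to fields along the hypersurface: expanding a field V
   along iota in the coordinate fields E_i of a chart of the ambient manifold and
   F E_i in the same frame, the equation nabla~ F = 0 applied to the E_i gives
   nabla~_v (F V) = F (nabla~_v V).  For V = Y tangent, expand both sides by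
   F Y = phi Y + eta*(Y) N, F N = xi and the Gauss and Weingarten formulas; the
   tangential parts are the first identity.  For the second one,
   differentiating g~(F Z, Y) = g~(Z, F* Y) shows that F* is parallel for the
   dual connection, and the same argument applies to the dual data. *)

Set Implicit Arguments.
Unset Strict Implicit.
Unset Printing Implicit Defensive.

(* [coord] alone would be [vector.coord]. *)
Local Notation coord := Defs.coord.

(** * Smooth maps between normed spaces *)

Section Differentials.
Context {R : realType} {V W : normedModType R}.

(** A differential depends only on the germ: the first-order expansion of [f] is one of [g], and
    such expansions are unique. This is used throughout, since chart identities hold only near a
    point. *)
Lemma near_eq_is_diff (f g df : V -> W) x :
  (\forall y \near x, f y = g y) -> is_diff x f df -> is_diff x g df.
Proof.
move=> fg [dif <-].
have gx : g x = f x by rewrite (nbhs_singleton fg).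
have [cdf fE] := (diff_locallyP _ _).1 dif.
have gE : g \o shift x = cst (g x) + 'd f x +o_ 0 id.
  apply/eqaddoP => e e0; rewrite gx.
  have /eqaddoP/(_ e e0) := fE.
  rewrite !near_simpl; apply: filter_app.
  have : \forall y \near 0, f (y + x) = g (y + x).
    by move: fg; rewrite (near_shift 0 x) subr0.
  by apply: filterS => y fgy; rewrite /= !fctE /= fgy.
have dg := diff_unique cdf gE.
apply: DiffDef; last by rewrite dg.
by apply/diff_locallyP; split; rewrite dg.
Qed.

Lemma is_diffE (f df : V -> W) x v : is_diff x f df -> 'd f x v = df v.
Proof. by case=> _ ->. Qed.

Lemma is_diff_sum m (f df : 'I_m -> V -> W) x :
  (forall i, is_diff x (f i) (df i)) ->
  is_diff x (fun y => \sum_i f i y) (fun v => \sum_i df i v).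
Proof.
move=> H.
have -> : (fun y => \sum_i f i y) = \sum_i f i.
  by apply/funext => y; rewrite fct_sumE.
have -> : (fun y => \sum_i df i y) = \sum_i df i.
  by apply/funext => y; rewrite fct_sumE.
elim/big_rec2: _ => [|i dg g _ Hg]; first exact: is_diff_cst.
exact: is_diffD.
Qed.

End Differentials.

Section DifferentialsRow.
Context {R : realType} {V : normedModType R} {m : nat}.
Implicit Types (f df : V -> 'rV[R]_m).

(** Packages an entry as a continuous linear map, so that the chain rule and the stability of
    smoothness under linear maps apply to it. *)
Lemma coord_linear j : exists2 L : {linear 'rV[R]_m -> R},
  continuous L & (forall u, L u = u 0 j).
Proof.
have lin : linear (fun u : 'rV[R]_m => u 0 j : R).
  by move=> a u v; rewrite !mxE.
pose LM := GRing.isLinear.Build _ _ _ _ _ lin.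
pose L : {linear 'rV[R]_m -> R} := HB.pack (fun u : 'rV[R]_m => u 0 j : R) LM.
by exists L => //; exact: coord_continuous.
Qed.

Lemma is_diff_coord f df x j : is_diff x f df ->
  is_diff x (fun y => f y 0 j) (fun v => df v 0 j).
Proof.
move=> H; have [L cL LE] := coord_linear j.
have -> : (fun y => f y 0 j) = L \o f by apply/funext => y; rewrite /= LE.
have -> : (fun v => df v 0 j) = L \o df by apply/funext => y; rewrite /= LE.
by apply: is_diff_comp; apply: DiffDef;
  [exact: linear_differentiable|rewrite diff_lin].
Qed.

Lemma is_diff_rV f df x :
  (forall j, is_diff x (fun y => f y 0 j) (fun v => df v 0 j)) ->
  is_diff x f df.
Proof.
move=> H.
have E (g : V -> 'rV[R]_m) : g = fun y => \sum_j g y 0 j *: delta_mx 0 j.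
  by apply/funext => y; rewrite -row_sum_delta.
rewrite (E f) (E df); apply: is_diff_sum => j.
apply: DiffDef; first exact: differentiableZl.
by rewrite diffZl // diff_val.
Qed.

(** The scalar product rule [is_diffM], applied to each entry. *)
Lemma is_diff_scale (h dh : V -> R) f df x :
  is_diff x h dh -> is_diff x f df ->
  is_diff x (fun y => h y *: f y) (fun v => dh v *: f x + h x *: df v).
Proof.
move=> Hh Hf; apply: is_diff_rV => j.
have Hj := is_diff_coord j Hf.
have -> : (fun y => (h y *: f y) 0 j) = h * (fun y => f y 0 j).
  by apply/funext => y; rewrite !mxE.
apply: is_diff_eq (is_diffM Hh Hj) _.
by apply/funext => v; rewrite !fctE !mxE addrC [X in X + _]mulrC.
Qed.

End DifferentialsRow.

(** * Stability properties of [Ck] and [smooth_at] *)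

Section Smoothness.
Context {R : realType}.

Lemma Ck_subset (V W : normedModType R) k (U U' : set V) (f : V -> W) :
  U' `<=` U -> Ck k U f -> Ck k U' f.
Proof.
move=> U'U; elim: k f => [|k IH] f /= => [fC x /U'U /fC//|[fd fC]].
by split=> [x /U'U /fd//|v]; exact: IH.
Qed.

(** Openness of [U] turns equality on [U] into equality of germs, so the directional derivatives
    again agree on [U] and the induction proceeds. *)
Lemma Ck_eq (V W : normedModType R) k (U : set V) (f g : V -> W) :
  open U -> (forall x, U x -> f x = g x) -> Ck k U f -> Ck k U g.
Proof.
move=> oU; have nU x : U x -> \near x, U x by move=> Ux; exact: open_nbhs_nbhs.
elim: k f g => [|k IH] f g fg /=.
  move=> fC x Ux; suff : g @ x --> f x by rewrite (fg x Ux).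
  by apply: cvg_trans (fC x Ux); apply: near_eq_cvg; apply: filterS (nU x Ux).
have fgn x : U x -> \forall y \near x, f y = g y.
  by move=> Ux; apply: filterS (nU x Ux).
move=> [fd fC]; split=> [x Ux|v].
  have := near_eq_is_diff (fgn x Ux) (differentiableP (fd x Ux)).
  by case.
apply: IH (fC v) => x Ux; exact: near_eq_derive (fgn x Ux).
Qed.

Lemma Ck_cst (V W : normedModType R) k (U : set V) (a : W) :
  Ck k U (fun _ : V => a).
Proof.
elim: k a => [|k IH] a /=; first by move=> x _; exact: cvg_cst.
split=> [x _|v]; first exact: differentiable_cst.
have -> : (fun x : V => 'D_v (fun=> a) x) = fun=> 0; last exact: IH.
by apply/funext => x; exact: derive_cst.
Qed.

Lemma Ck_add (V W : normedModType R) k (U : set V) (f g : V -> W) :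
  open U -> Ck k U f -> Ck k U g -> Ck k U (fun x => f x + g x).
Proof.
move=> oU; elim: k f g => [|k IH] f g /=.
  by move=> fC gC x Ux; apply: cvgD; [exact: fC|exact: gC].
move=> [fd fC] [gd gC]; split=> [x Ux|v].
  by apply: differentiableD; [exact: fd|exact: gd].
apply: Ck_eq (IH _ _ (fC v) (gC v)) => // x Ux.
by rewrite -deriveD //; apply: diff_derivable; [exact: fd|exact: gd].
Qed.

(** The induction works because [L] commutes with directional derivatives on [U]. *)
Lemma Ck_linear (V W Z : normedModType R) k (U : set V) (f : V -> W)
    (L : {linear W -> Z}) :
  open U -> continuous L -> Ck k U f -> Ck k U (fun x => L (f x)).
Proof.
move=> oU cL; have dL y : is_diff y L L.
  by apply: DiffDef; [exact: linear_differentiable|rewrite diff_lin].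
elim: k f => [|k IH] f /=.
  by move=> fC x Ux; apply: continuous_comp; [exact: fC|exact: cL].
move=> [fd fC].
have dLf x : U x -> is_diff x (fun y => L (f y)) (fun v => L ('d f x v)).
  by move=> /fd /differentiableP Hf; exact: is_diff_comp.
split=> [x /dLf[]//|v].
apply: Ck_eq (IH _ (fC v)) => // x Ux; have := dLf x Ux; case=> dl El.
by rewrite !deriveE ?El //; exact: fd.
Qed.

Lemma smooth_at_eq (V W : normedModType R) (f g : V -> W) x :
  (\forall y \near x, f y = g y) -> smooth_at f x -> smooth_at g x.
Proof.
rewrite -nbhs_nearE nbhsE => -[B [oB Bx] BE] [U [oU Ux fU]].
exists (U `&` B); split=> [|//|k]; first exact: openI.
apply: (@Ck_eq _ _ _ _ f); [exact: openI|by move=> y [_ /BE]|].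
exact: Ck_subset (fU k).
Qed.

Lemma smooth_at_cst (V W : normedModType R) (a : W) (x : V) :
  smooth_at (fun _ : V => a) x.
Proof. by exists setT; split=> [|//|k]; [exact: openT|exact: Ck_cst]. Qed.

Lemma smooth_at_add (V W : normedModType R) (f g : V -> W) x :
  smooth_at f x -> smooth_at g x -> smooth_at (fun y => f y + g y) x.
Proof.
move=> [U [oU Ux fU]] [U' [oU' U'x gU']].
exists (U `&` U'); split=> [|//|k]; first exact: openI.
by apply: Ck_add; [exact: openI|exact: Ck_subset (fU k)|exact: Ck_subset (gU' k)].
Qed.

Lemma smooth_at_linear (V W Z : normedModType R) (f : V -> W)
    (L : {linear W -> Z}) x :
  continuous L -> smooth_at f x -> smooth_at (fun y => L (f y)) x.
Proof.
by move=> cL [U [oU Ux fU]]; exists U; split=> // k; exact: Ck_linear.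
Qed.

Lemma smooth_at_coord (V : normedModType R) m (f : V -> 'rV[R]_m) x j :
  smooth_at f x -> smooth_at (fun y => f y 0 j) x.
Proof.
have [L cL LE] := @coord_linear R m j.
have -> : (fun y => f y 0 j) = (fun y => L (f y)).
  by apply/funext => y; rewrite LE.
exact: smooth_at_linear.
Qed.

Lemma smooth_at_scalel (V W : normedModType R) (f : V -> R) (w : W) x :
  smooth_at f x -> smooth_at (fun y => f y *: w) x.
Proof.
have lin : linear (fun a : R => a *: w).
  by move=> a b c; rewrite scalerDl scalerA.
pose LM := GRing.isLinear.Build _ _ _ _ _ lin.
pose L : {linear R -> W} := HB.pack (fun a : R => a *: w) LM.
exact: (@smooth_at_linear _ _ _ f L x (@scalel_continuous _ _ w)).
Qed.

Lemma smooth_at_differentiable (V W : normedModType R) (f : V -> W) x :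
  smooth_at f x -> differentiable f x.
Proof. by move=> [U [_ Ux /(_ 1%N)[fd _]]]; exact: fd. Qed.

Lemma smooth_at_near_differentiable (V W : normedModType R) (f : V -> W) x :
  smooth_at f x -> \forall y \near x, differentiable f y.
Proof.
move=> [U [oU Ux /(_ 1%N)[fd _]]].
by apply: filterS (open_nbhs_nbhs (conj oU Ux)).
Qed.

Lemma smooth_at_derive (V W : normedModType R) (f : V -> W) x v :
  smooth_at f x -> differentiable (fun y => 'D_v f y) x.
Proof. by move=> [U [_ Ux /(_ 2%N)[_ /(_ v)[fd _]]]]; exact: fd. Qed.

(** Near [x] the value is the finite sum of the entries of [u] times the partial derivatives of [f],
    and each factor is differentiable at [x]. It serves to differentiate [dmap iota q (Y q)] in
    charts. *)
Lemma smooth_at_diff_differentiable (n m : nat)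
    (f : 'rV[R]_n -> 'rV[R]_m) (u : 'rV[R]_n -> 'rV[R]_n) x :
  smooth_at f x -> differentiable u x ->
  differentiable (fun y => 'd f y (u y)) x.
Proof.
move=> fs ud.
pose s y := \sum_j u y 0 j *: 'D_(delta_mx 0 j) f y.
have [//] : is_diff x (fun y => 'd f y (u y)) ('d s x).
have sd : is_diff x s ('d s x).
  apply: differentiableP.
  suff [//] : is_diff x s (fun v => \sum_j ('d u x v 0 j *:
    'D_(delta_mx 0 j) f x + u x 0 j *: 'd (fun y => 'D_(delta_mx 0 j) f y) x v)).
  apply: is_diff_sum => j; apply: is_diff_scale.
    exact/is_diff_coord/differentiableP.
  exact/differentiableP/smooth_at_derive.
apply: near_eq_is_diff sd.
apply: filterS (smooth_at_near_differentiable fs) => y fy.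
rewrite [in RHS](row_sum_delta (u y)) linear_sum; apply: eq_bigr => j _.
by rewrite linearZ /= deriveE.
Qed.

End Smoothness.

(** * Charts and vector fields *)

Section Charts.
Context {R : realType}.

Lemma near_chart_inv n (M : manifold R n) (p x : M) (P : M -> Prop) :
  dom p x -> (\forall y \near x, P y) ->
  \forall y \near chart p x, P (chart_inv p y).
Proof.
move=> px; have C : chart_inv p @ chart p x --> chart_inv p (chart p x).
  exact: chart_inv_continuous (chart_img px).
by rewrite chartK // in C; exact: C.
Qed.

Lemma near_dom n (M : manifold R n) (p x : M) :
  dom p x -> \forall y \near x, dom p y.
Proof. by move=> px; exact: open_nbhs_nbhs (conj (dom_open p) px). Qed.

Lemma near_img n (M : manifold R n) (p x : M) :
  dom p x -> \forall y \near chart p x, img p y.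
Proof.
move=> px; apply: open_nbhs_nbhs; split; [exact: img_open|exact: chart_img].
Qed.

(** The chain rule read in three charts. The inner [chart_inv q] and [chart q] cancel only where [f]
    stays in [dom q], which by continuity is a neighbourhood of [x]. *)
Lemma is_diff_chart_comp n1 n2 n3 (M1 : manifold R n1) (M2 : manifold R n2)
    (M3 : manifold R n3) (f : M1 -> M2) (g : M2 -> M3) p q r x :
  dom p x -> {for x, continuous f} -> dom q (f x) ->
  differentiable (fun y => chart q (f (chart_inv p y))) (chart p x) ->
  differentiable (fun y => chart r (g (chart_inv q y))) (chart q (f x)) ->
  is_diff (chart p x) (fun y => chart r (g (f (chart_inv p y))))
    (fun v => 'd (fun y => chart r (g (chart_inv q y))) (chart q (f x))
                ('d (fun y => chart q (f (chart_inv p y))) (chart p x) v)).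
Proof.
move=> px fx qfx df dg.
have := @is_diff_comp _ _ _ _ (fun y => chart q (f (chart_inv p y)))
  ('d (fun y => chart q (f (chart_inv p y))) (chart p x))
  (fun y => chart r (g (chart_inv q y)))
  ('d (fun y => chart r (g (chart_inv q y))) (chart q (f x))) (chart p x).
move=> /(_ (differentiableP df)); rewrite chartK //.
move=> /(_ (differentiableP dg)); apply: near_eq_is_diff.
have /(near_chart_inv px) : \forall z \near x, dom q (f z).
  exact: fx _ (near_dom qfx).
by apply: filterS => y qfy /=; rewrite chartK.
Qed.

Section OneManifold.
Context {n : nat} {M : manifold R n}.
Implicit Types (p q r x : M) (v : 'rV[R]_n).

Lemma transition_differentiable p q x : dom p x -> dom q x ->
  differentiable (fun y => chart q (chart_inv p y)) (chart p x).
Proof. by move=> px qx; exact/smooth_at_differentiable/transition_smooth. Qed.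

(** Cocycle rule for the differentials of transition maps: the chain rule above with both maps the
    identity. *)
Lemma transition_comp p q r x v : dom p x -> dom q x -> dom r x ->
  'd (fun y => chart r (chart_inv q y)) (chart q x)
    ('d (fun y => chart q (chart_inv p y)) (chart p x) v) =
  'd (fun y => chart r (chart_inv p y)) (chart p x) v.
Proof.
move=> px qx rx.
have C : {for x, continuous (@idfun M)} by exact: cvg_id.
exact/esym/(is_diffE v (@is_diff_chart_comp n n n M M M idfun idfun p q r x px C
  qx (transition_differentiable px qx) (transition_differentiable qx rx))).
Qed.

Lemma transition_id p x v : dom p x ->
  'd (fun y => chart p (chart_inv p y)) (chart p x) v = v.
Proof.
move=> px.
apply: (@is_diffE _ _ _ (fun y => chart p (chart_inv p y)) id).
apply: near_eq_is_diff (is_diff_id _).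
by apply: filterS (near_img px) => y py; rewrite chart_invK.
Qed.

Lemma coord_id p v : coord p p v = v.
Proof. exact/transition_id/dom_self. Qed.

Lemma coordD p x v w : coord p x (v + w) = coord p x v + coord p x w.
Proof. exact: linearD. Qed.

Lemma coordZ p x a v : coord p x (a *: v) = a *: coord p x v.
Proof. exact: linearZ. Qed.

(* [coord_field p i] is convertible to [constant_field p (delta_mx 0 i)]. *)
Definition constant_field p (c : 'rV[R]_n) x : 'rV[R]_n :=
  'd (fun y => chart x (chart_inv p y)) (chart p x) c.

(** Both maps are differentials of transitions, in opposite directions; by the cocycle rule they
    compose to the differential of a chart change from a chart to itself. *)
Lemma coord_constant_field p x c : dom p x ->
  coord p x (constant_field p c x) = c.
Proof.
move=> px; rewrite /coord /constant_field transition_comp ?transition_id //.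
exact: dom_self.
Qed.

Lemma constant_field_coord p x v : dom p x ->
  constant_field p (coord p x v) x = v.
Proof.
move=> px; rewrite /coord /constant_field transition_comp ?transition_id //;
  exact: dom_self.
Qed.

Lemma constant_field_id p c : constant_field p c p = c.
Proof. exact/transition_id/dom_self. Qed.

Lemma sum_coord_field p x v : dom p x ->
  v = \sum_i coord p x v 0 i *: coord_field p i x.
Proof.
move=> px; rewrite -[LHS](constant_field_coord v px) /constant_field.
rewrite [X in 'd _ _ X]row_sum_delta linear_sum.
by apply: eq_bigr => i _; rewrite linearZ.
Qed.

Lemma near_chart_img p (P : M -> Prop) : (\forall x \near p, P x) ->
  \forall y \near chart p p, P (chart_inv p y).
Proof. exact/near_chart_inv/dom_self. Qed.

(** In [chart p] the local expression is the constant [c] near [chart p p]. *)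
Lemma smooth_constant_field p c : smooth_field_at (constant_field p c) p.
Proof.
apply: smooth_at_eq (smooth_at_cst c _).
have /near_chart_img := near_dom (dom_self p).
apply: filterS => y px; rewrite /local_rep /=.
by rewrite coord_constant_field.
Qed.

Lemma smooth_fieldD p (Y Z : M -> 'rV[R]_n) :
  smooth_field_at Y p -> smooth_field_at Z p ->
  smooth_field_at (fun q => Y q + Z q) p.
Proof.
move=> Ys Zs; rewrite /smooth_field_at /smooth_along_at.
have -> : local_rep (@idfun M) (fun q => Y q + Z q) p =
    fun y => local_rep (@idfun M) Y p y + local_rep (@idfun M) Z p y.
  by apply/funext => y; rewrite /local_rep coordD.
exact: smooth_at_add.
Qed.

Lemma smooth_field0 p : smooth_field_at (fun _ : M => 0) p.
Proof.
rewrite /smooth_field_at /smooth_along_at.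
have -> : local_rep (@idfun M) (fun=> 0) p = fun=> 0.
  by apply/funext => y; rewrite /local_rep /coord linear0.
exact: smooth_at_cst.
Qed.

Lemma smooth_field_sum p m (Y : 'I_m -> M -> 'rV[R]_n) :
  (forall i, smooth_field_at (Y i) p) ->
  smooth_field_at (fun q => \sum_i Y i q) p.
Proof.
move=> Ys; have -> : (fun q => \sum_i Y i q) = \sum_i Y i.
  by apply/funext => y; rewrite fct_sumE.
elim/big_ind: _ => [|Y1 Y2|i _]; [exact: smooth_field0|exact: smooth_fieldD|].
exact: Ys.
Qed.

Lemma smooth_scale_coord_field p (h : M -> R) i : smooth_fun_at h p ->
  smooth_field_at (fun q => h q *: coord_field p i q) p.
Proof.
move=> hs; apply: smooth_at_eq (smooth_at_scalel (delta_mx 0 i) hs).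
have /near_chart_img := near_dom (dom_self p).
apply: filterS => y px; rewrite /local_rep /=.
by rewrite coordZ (coord_constant_field _ px).
Qed.

Lemma smooth_coord p (Y : M -> 'rV[R]_n) i : smooth_field_at Y p ->
  smooth_fun_at (fun q => coord p q (Y q) 0 i) p.
Proof. exact: smooth_at_coord. Qed.

End OneManifold.
End Charts.

(** * Covariant derivatives *)

Section Connections.
Context {R : realType} {n : nat} {M : manifold R n}.
Variable nabla : M -> 'rV[R]_n -> (M -> 'rV[R]_n) -> 'rV[R]_n.
Hypothesis conn : affine_connection nabla.

Lemma conn_near_eq p v Y Z :
  smooth_field_at Y p -> smooth_field_at Z p ->
  (\forall q \near p, Y q = Z q) -> nabla p v Y = nabla p v Z.
Proof.
(* [chi] vanishes where Y and Z differ, so [chi *: Y = chi *: Z] globally and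
   the Leibniz rule applies to both sides. *)
move=> Ys Zs YZ; pose chi q : R := if `[< Y q = Z q >] then 1 else 0.
have chi1 : \forall y \near chart p p, 1 = chi (chart_inv p y).
  by apply: filterS (near_chart_img YZ) => y E; rewrite /chi asboolT.
have chis : smooth_fun_at chi p by exact: smooth_at_eq chi1 (smooth_at_cst _ _).
have chid : dirder chi p v = 0.
  exact: is_diffE v (near_eq_is_diff chi1 (is_diff_cst (1 : R) (chart p p))).
have chip : chi p = 1 by rewrite /chi asboolT //; exact: nbhs_singleton YZ.
have E : (fun q => chi q *: Y q) = (fun q => chi q *: Z q).
  by apply/funext => q; rewrite /chi; case: asboolP => [->//|]; rewrite !scale0r.
have := conn_leibniz conn v chis Ys; rewrite E (conn_leibniz conn v chis Zs).
by rewrite chid chip !scale0r !add0r !scale1r.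
Qed.

Lemma conn0 p v : nabla p v (fun _ => 0) = 0.
Proof.
have := conn_add conn v (smooth_field0 p) (smooth_field0 p).
under [fun q => 0 + 0]funext do rewrite addr0.
by move/eqP; rewrite -subr_eq subrr => /eqP <-.
Qed.

Lemma conn_sum p v m (Y : 'I_m -> M -> 'rV[R]_n) :
  (forall i, smooth_field_at (Y i) p) ->
  nabla p v (fun q => \sum_i Y i q) = \sum_i nabla p v (Y i).
Proof.
move=> Ys; have -> : (fun q => \sum_i Y i q) = \sum_i Y i.
  by apply/funext => y; rewrite fct_sumE.
(* Smoothness of the partial sums is carried through the induction, since [conn_add] requires it. *)
have [] : smooth_field_at (\sum_i Y i) p /\
    nabla p v (\sum_i Y i) = \sum_i nabla p v (Y i); last by [].
elim/big_rec2: _ => [|i Z u _ [us uE]].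
  by split; [exact: smooth_field0|exact: conn0].
split; first exact: smooth_fieldD.
by rewrite -uE; exact: conn_add.
Qed.

(** The coordinate formula of a connection, of the same shape as [cov_along] for the identity map.
    The expansion of [Y] in the coordinate frame holds only near [p], so [conn_near_eq] brings it
    in; the Leibniz rule does the rest. *)
Lemma conn_coord p v Y : smooth_field_at Y p ->
  nabla p v Y = 'd (local_rep (@idfun M) Y p) (chart p p) v
    + \sum_i Y p 0 i *: nabla p v (coord_field p i).
Proof.
move=> Ys; pose h i q := coord p q (Y q) 0 i.
have hs i : smooth_fun_at (h i) p by exact: smooth_coord.
have Es i : smooth_field_at (coord_field p i) p by exact: smooth_constant_field.
have hEs i : smooth_field_at (fun q => h i q *: coord_field p i q) p.
  exact: smooth_scale_coord_field.
have YE : \forall q \near p, Y q = \sum_i h i q *: coord_field p i q.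
  by apply: filterS (near_dom (dom_self p)) => q pq; exact: sum_coord_field.
rewrite (conn_near_eq v Ys (smooth_field_sum hEs) YE) conn_sum //.
under eq_bigr do rewrite (conn_leibniz conn v (hs _) (Es _)).
rewrite big_split /=; congr (_ + _); last first.
  by apply: eq_bigr => i _; rewrite /h coord_id.
rewrite [RHS]row_sum_delta; apply: eq_bigr => i _.
rewrite (_ : coord_field p i p = delta_mx 0 i); last exact: constant_field_id.
have Yd := differentiableP (smooth_at_differentiable Ys).
by rewrite /dirder (is_diffE v (is_diff_coord i Yd)).
Qed.

End Connections.

(** * Pointwise linearity of tensor fields *)

Lemma tensor_sum (R : realType) (n : nat) (M : manifold R n)
    (F : M -> 'rV[R]_n -> 'rV[R]_n) p m (a : 'I_m -> R) (u : 'I_m -> 'rV[R]_n) :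
  tensor11 F -> F p (\sum_i a i *: u i) = \sum_i a i *: F p (u i).
Proof.
move=> [lin _].
pose FM := GRing.isLinear.Build _ _ _ _ _ (lin p).
pose L : {linear 'rV[R]_n -> 'rV[R]_n} := HB.pack (F p) FM.
rewrite -[F p]/(L : _ -> _) linear_sum.
by apply: eq_bigr => i _; rewrite linearZ.
Qed.

Lemma tensorD (R : realType) (n : nat) (M : manifold R n)
    (F : M -> 'rV[R]_n -> 'rV[R]_n) p u v :
  tensor11 F -> F p (u + v) = F p u + F p v.
Proof. by move=> [lin _]; rewrite -[u in LHS]scale1r lin scale1r. Qed.

Lemma tensor0 (R : realType) (n : nat) (M : manifold R n)
    (F : M -> 'rV[R]_n -> 'rV[R]_n) p : tensor11 F -> F p 0 = 0.
Proof.
by move=> TF; apply: (addIr (F p 0)); rewrite -tensorD // !add0r.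
Qed.

Lemma tensorZ (R : realType) (n : nat) (M : manifold R n)
    (F : M -> 'rV[R]_n -> 'rV[R]_n) p a v :
  tensor11 F -> F p (a *: v) = a *: F p v.
Proof.
by move=> TF; have := TF.1 p a v 0; rewrite tensor0 // !addr0.
Qed.

(** * Covariant derivatives of fields along a smooth map *)

Section CovariantAlong.
Context {R : realType} {n m : nat} {M : manifold R n} {Mt : manifold R m}.
Context {iota : M -> Mt}.
Hypothesis iota_smooth : smooth_map iota.
Variable nabla : Mt -> 'rV[R]_m -> (Mt -> 'rV[R]_m) -> 'rV[R]_m.
Implicit Types (p : M) (v : 'rV[R]_n) (V W : M -> 'rV[R]_m).

Lemma local_rep_id V p : local_rep iota V p (chart p p) = V p.
Proof.
by rewrite /local_rep (chartK (dom_self p)) coord_id.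
Qed.

Lemma cov_along_is_diff p v V dV :
  is_diff (chart p p) (local_rep iota V p) dV ->
  cov_along iota nabla p v V = dV v
  + \sum_i V p 0 i *: nabla (iota p) (dmap iota p v) (coord_field (iota p) i).
Proof. by move=> Vd; congr (_ + _); exact: is_diffE. Qed.

Lemma cov_alongD p v V W :
  differentiable (local_rep iota V p) (chart p p) ->
  differentiable (local_rep iota W p) (chart p p) ->
  cov_along iota nabla p v (fun q => V q + W q) =
    cov_along iota nabla p v V + cov_along iota nabla p v W.
Proof.
move=> /differentiableP Vd /differentiableP Wd.
have E : local_rep iota V p + local_rep iota W p =
    local_rep iota (fun q => V q + W q) p.
  by apply/funext => y; rewrite /local_rep coordD.
have := is_diffD Vd Wd; rewrite E => /(cov_along_is_diff v) ->.
rewrite addrACA; congr (_ + _).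
by rewrite -big_split; apply: eq_bigr => i _; rewrite mxE scalerDl.
Qed.

(** Stated apart from [cov_alongZ] because it also yields the differentiability of the normal part
    of [F Y], which [cov_alongD] requires. *)
Lemma is_diff_alongZ p h V :
  smooth_fun_at h p -> differentiable (local_rep iota V p) (chart p p) ->
  is_diff (chart p p) (local_rep iota (fun q => h q *: V q) p)
    (fun v => dirder h p v *: V p
              + h p *: 'd (local_rep iota V p) (chart p p) v).
Proof.
move=> hs /differentiableP Vd.
have hd := differentiableP (smooth_at_differentiable hs).
have E : (fun y => h (chart_inv p y) *: local_rep iota V p y) =
    local_rep iota (fun q => h q *: V q) p.
  by apply/funext => y; rewrite /local_rep coordZ.
by have := is_diff_scale hd Vd; rewrite local_rep_id (chartK (dom_self p)) E.
Qed.

Lemma cov_alongZ p v h V :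
  smooth_fun_at h p -> differentiable (local_rep iota V p) (chart p p) ->
  cov_along iota nabla p v (fun q => h q *: V q) =
    dirder h p v *: V p + h p *: cov_along iota nabla p v V.
Proof.
move=> hs Vd; rewrite (cov_along_is_diff v (is_diff_alongZ hs Vd)).
rewrite -addrA scalerDr; congr (_ + (_ + _)).
by rewrite scaler_sumr; apply: eq_bigr => i _; rewrite mxE scalerA.
Qed.

Lemma near_iota_dom p : \forall x \near p, dom (iota p) (iota x).
Proof. exact: (iota_smooth.1 p) (near_dom (dom_self (iota p))). Qed.

(** Both sides differentiate [iota] read from [chart x] to [chart (iota p)]: the left one factors
    through [chart (iota x)], the right one through [chart p]. *)
Lemma coord_dmap p x w : dom p x -> dom (iota p) (iota x) ->
  differentiable (fun y => chart (iota p) (iota (chart_inv p y))) (chart p x) ->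
  coord (iota p) (iota x) (dmap iota x w) =
  'd (fun y => chart (iota p) (iota (chart_inv p y))) (chart p x) (coord p x w).
Proof.
move=> px ipx fd; have ci := iota_smooth.1.
have cid : {for x, continuous (@idfun M)} by exact: cvg_id.
have xd := smooth_at_differentiable (iota_smooth.2 x).
have td := transition_differentiable (dom_self (iota x)) ipx.
have td' := transition_differentiable (dom_self x) px.
have := is_diffE w (@is_diff_chart_comp _ _ _ _ M Mt Mt iota idfun x (iota x)
  (iota p) x (dom_self x) (ci x) (dom_self (iota x)) xd td).
have := is_diffE w (@is_diff_chart_comp _ _ _ _ M M Mt idfun iota x p
  (iota p) x (dom_self x) cid px td' fd).
by move=> E1 E2; exact: etrans (esym E2) E1.
Qed.

(** By [coord_dmap], the local expression is, near [chart p p], the differential of the local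
    expression of [iota] applied to that of [Y]. *)
Lemma differentiable_dmap p (Y : M -> 'rV[R]_n) : smooth_field_at Y p ->
  differentiable (local_rep iota (fun q => dmap iota q (Y q)) p) (chart p p).
Proof.
move=> Ys; have fs := iota_smooth.2 p.
have := differentiableP
  (smooth_at_diff_differentiable fs (smooth_at_differentiable Ys)).
set u := 'd _ _ => ud.
suff [//] : is_diff (chart p p)
  (local_rep iota (fun q => dmap iota q (Y q)) p) u.
apply: near_eq_is_diff ud.
have domp := near_chart_img (near_dom (dom_self p)).
have domi := near_chart_img (near_iota_dom p).
near=> y.
have py : img p y by near: y; exact: near_img (dom_self p).
rewrite /local_rep coord_dmap ?chart_invK //.
- by near: y; exact: domp.
- by near: y; exact: domi.
- by near: y; exact: smooth_at_near_differentiable fs.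
Unshelve. all: by end_near. Qed.

Variable F : Mt -> 'rV[R]_m -> 'rV[R]_m.
Hypotheses (conn : affine_connection nabla) (tensF : tensor11 F).

(** Near the base point [F V] reads as the sum of the components of [V] times [G i] composed with
    [f], where [G i] expresses [F] of the [i]-th coordinate field and [f] expresses [iota]. The
    product and chain rules give the differential. *)
Lemma is_diff_local_rep_tensor p V :
  differentiable (local_rep iota V p) (chart p p) ->
  is_diff (chart p p) (local_rep iota (fun q => F (iota q) (V q)) p)
   (fun v => \sum_i ('d (local_rep iota V p) (chart p p) v 0 i
        *: F (iota p) (delta_mx 0 i)
      + V p 0 i *: 'd (local_rep (@idfun Mt)
           (fun q => F q (coord_field (iota p) i q)) (iota p))
           (chart (iota p) (iota p)) (dmap iota p v))).
Proof.
move=> Vd.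
pose G i := local_rep (@idfun Mt)
  (fun q => F q (coord_field (iota p) i q)) (iota p).
pose f y := chart (iota p) (iota (chart_inv p y)).
have fp : f (chart p p) = chart (iota p) (iota p).
  by rewrite /f (chartK (dom_self p)).
have Gp i : G i (chart (iota p) (iota p)) = F (iota p) (delta_mx 0 i).
  rewrite /G /local_rep (chartK (dom_self (iota p))) /= coord_id.
  by congr (F _ _); exact: constant_field_id.
have Gf i : is_diff (chart p p) (fun y => G i (f y)) (fun v =>
    'd (G i) (chart (iota p) (iota p)) (dmap iota p v)).
  apply: (@is_diff_comp _ _ _ _ f _ (G i)
    ('d (G i) (chart (iota p) (iota p)))).
    exact/differentiableP/smooth_at_differentiable/iota_smooth.2.
  rewrite fp; apply/differentiableP/smooth_at_differentiable.
  exact/tensF.2/smooth_constant_field.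
have : is_diff (chart p p)
    (fun y => \sum_i local_rep iota V p y 0 i *: G i (f y))
    (fun v => \sum_i ('d (local_rep iota V p) (chart p p) v 0 i
        *: F (iota p) (delta_mx 0 i)
      + V p 0 i *: 'd (G i) (chart (iota p) (iota p)) (dmap iota p v))).
  apply: is_diff_sum => i.
  have := is_diff_scale (is_diff_coord i (differentiableP Vd)) (Gf i).
  by rewrite fp Gp local_rep_id.
(* The frame expansion of [V] is valid only where [iota] stays in [dom (iota p)]. *)
apply: near_eq_is_diff.
apply: filterS (near_chart_img (near_iota_dom p)) => y iy.
rewrite /local_rep [in RHS](sum_coord_field (V _) iy) (tensor_sum _ _ _ tensF).
rewrite /coord linear_sum; apply: eq_bigr => i _; rewrite linearZ /=.
by rewrite /G /f /local_rep (chartK iy).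
Qed.

(** [V] need not extend to an ambient field, so parallelism is applied to the coordinate fields and
    carried over to [V] through its components. *)
Lemma cov_along_tensor p v V :
  (forall w Y, smooth_field_at Y (iota p) ->
     cov_tensor11 nabla F (iota p) w Y = 0) ->
  differentiable (local_rep iota V p) (chart p p) ->
  cov_along iota nabla p v (fun q => F (iota q) (V q)) =
  F (iota p) (cov_along iota nabla p v V).
Proof.
move=> par Vd; rewrite (cov_along_is_diff v (is_diff_local_rep_tensor Vd)) /cov_along.
set dV := 'd (local_rep iota V p) _ v; set v' := dmap iota p v.
rewrite tensorD // tensor_sum // [in RHS](row_sum_delta dV) tensor_sum //.
rewrite big_split /= -addrA; congr (_ + _).
(* Parallelism on the [i]-th coordinate field, with the derivative of its image under [F] expanded
   by [conn_coord] and solved for the differential. *)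
have dG i : 'd (local_rep (@idfun Mt)
      (fun q => F q (coord_field (iota p) i q)) (iota p))
      (chart (iota p) (iota p)) v' =
    F (iota p) (nabla (iota p) v' (coord_field (iota p) i))
    - \sum_j F (iota p) (delta_mx 0 i) 0 j
        *: nabla (iota p) v' (coord_field (iota p) j).
  have Es : smooth_field_at (coord_field (iota p) i) (iota p).
    exact: smooth_constant_field.
  have /eqP := par v' _ Es; rewrite subr_eq0 => /eqP <-.
  rewrite (conn_coord conn _ (tensF.2 _ _ Es)).
  rewrite (_ : coord_field (iota p) i (iota p) = delta_mx 0 i) ?addrK //.
  exact: constant_field_id.
under eq_bigr do rewrite dG scalerBr.
(* The subtracted double sum cancels the frame term of [F V]: after exchanging the sums, the
   coefficient of the [j]-th frame derivative is the [j]-th entry of [F (iota p) (V p)]. *)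
rewrite sumrB -addrA [X in _ + X]addrC [X in _ + X](_ : _ = 0) ?addr0 //.
apply/eqP; rewrite subr_eq0; apply/eqP.
under [RHS]eq_bigr do rewrite scaler_sumr.
rewrite exchange_big /=; apply: eq_bigr => j _.
rewrite [V p](row_sum_delta (V p)) tensor_sum // summxE scaler_suml.
by apply: eq_bigr => i _; rewrite -row_sum_delta mxE scalerA.
Qed.

End CovariantAlong.

(** * Duality, and the tangential part of the parallelism equation *)

Lemma dual_parallel (R : realType) (n : nat) (M : manifold R n)
    (g : M -> 'rV[R]_n -> 'rV[R]_n -> R)
    (nabla nablas : M -> 'rV[R]_n -> (M -> 'rV[R]_n) -> 'rV[R]_n)
    (F Fs : M -> 'rV[R]_n -> 'rV[R]_n) p v Y :
  locally_product_like_statistical_manifold g nabla F Fs ->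
  dual_connection g nabla nablas -> smooth_field_at Y p ->
  cov_tensor11 nablas Fs p v Y = 0.
Proof.
move=> [[met _ _ _] TF TFs _ par adj] [_ dual] Ys.
set z := cov_tensor11 _ _ _ _ _.
(* Positive definiteness, applied with [w] equal to [z], forces [z] to vanish. A general [w] is then
   extended to a field smooth near [p]. *)
suff gz w : g p z w = 0.
  by apply/eqP; apply: contra_eqT (gz z) => /(metric_pos met p) /lt0r_neq0.
have Xs := smooth_constant_field p w.
have XE : constant_field p w p = w by exact: constant_field_id.
(* By adjointness one function is differentiated in two ways; once [par] and [adj] are used, both
   expansions share the term pairing the derivative of the extended field with [Fs Y]. *)
have := dual p v _ _ (TF.2 _ _ Xs) Ys.
under [fun q => g q (F q _) _]funext do rewrite adj.
rewrite (dual p v _ _ Xs (TFs.2 _ _ Ys)) !XE.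
have /eqP := par p v _ Xs; rewrite subr_eq0 => /eqP ->.
rewrite !adj => /addIr E.
rewrite /z /cov_tensor11 addrC -scaleN1r (metric_lin met) mulN1r.
by rewrite ![g p _ w](Defs.metric_sym met) E addNr.
Qed.

(** Common form of the two identities: [h] stands for the second fundamental form in direction [v],
    [Av] for the shape operator applied to [v], and [eta] for whichever form gives the normal part
    of [F]. *)
Lemma gauss_weingarten_tensor (R : realType) (n m : nat) (M : manifold R n)
    (Mt : manifold R m) (iota : M -> Mt) (g : Mt -> 'rV[R]_m -> 'rV[R]_m -> R)
    (nablat : Mt -> 'rV[R]_m -> (Mt -> 'rV[R]_m) -> 'rV[R]_m)
    (F : Mt -> 'rV[R]_m -> 'rV[R]_m) (N : M -> 'rV[R]_m)
    (nabla : M -> 'rV[R]_n -> (M -> 'rV[R]_n) -> 'rV[R]_n)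
    (phi : M -> 'rV[R]_n -> 'rV[R]_n) (eta : M -> 'rV[R]_n -> R)
    p (xi v Av : 'rV[R]_n) (h : 'rV[R]_n -> R) (kappa : R) (Y : M -> 'rV[R]_n) :
  riemannian_metric g -> immersion iota -> unit_normal iota g N ->
  affine_connection nablat -> tensor11 F ->
  (forall w Z, smooth_field_at Z (iota p) ->
     cov_tensor11 nablat F (iota p) w Z = 0) ->
  tensor11 phi -> one_form eta ->
  F (iota p) (N p) = dmap iota p xi ->
  (forall q w, F (iota q) (dmap iota q w) =
     dmap iota q (phi q w) + eta q w *: N q) ->
  (forall Z, smooth_field_at Z p ->
     cov_along iota nablat p v (fun q => dmap iota q (Z q)) =
     dmap iota p (nabla p v Z) + h (Z p) *: N p) ->
  cov_along iota nablat p v N = - dmap iota p Av + kappa *: N p ->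
  smooth_field_at Y p ->
  cov_tensor11 nabla phi p v Y = h (Y p) *: xi + eta p (Y p) *: Av.
Proof.
move=> met [ismooth inj] [Ns NN NT] conn TF par Tphi Oeta FN FT gauss wein Ys.
have Nd := smooth_at_differentiable (Ns p).
have phiY := Tphi.2 _ _ Ys; have etaY := Oeta.2 _ _ Ys.
have := cov_along_tensor ismooth conn TF v par (differentiable_dmap ismooth Ys).
under [fun q => F _ _]funext do rewrite FT.
rewrite (cov_alongD _ _ (differentiable_dmap ismooth phiY)); last first.
  by case: (is_diff_alongZ etaY Nd).
rewrite (cov_alongZ _ _ etaY Nd) !gauss // wein.
rewrite tensorD // tensorZ // FN FT /cov_tensor11 => E.
set d := nabla p v _ - _; set e := _ + _.
have [t tE] : exists t, dmap iota p (d - e) = t *: N p.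
  (* The coefficients of [N] in [E], right side minus left side. What remains of [E] is the image
     under [dmap iota p] of [d - e]. *)
  exists (eta p (nabla p v Y) - h (phi p (Y p))
    - dirder (fun q => eta q (Y q)) p v - eta p (Y p) * kappa).
  have -> : dmap iota p (d - e) = dmap iota p (nabla p v (fun q => phi q (Y q)))
      - dmap iota p (phi p (nabla p v Y))
      - (h (Y p) *: dmap iota p xi + eta p (Y p) *: dmap iota p Av).
    by rewrite /d /e /dmap linearB linearB linearD !linearZ.
  apply/rowP => j; move/rowP/(_ j): E; rewrite !mxE => E.
  lra.
(* [metric_lin] concerns vectors of the form [a *: u + v]; the value at zero lets it apply to
   [t *: N p]. *)
have g0 : g (iota p) 0 (N p) = 0.
  by rewrite (Defs.metric_sym met) -[RHS](NT p 0) /dmap linear0.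
(* The vector [t *: N p] is tangent, hence orthogonal to the unit vector [N p]. With [t] zero,
   injectivity of [dmap iota p] gives the identity on [M]. *)
have t0 : t = 0.
  have := NT p (d - e); rewrite tE (Defs.metric_sym met) -[t *: N p]addr0.
  by rewrite (metric_lin met) NN g0 mulr1 addr0.
apply/eqP; rewrite -subr_eq0; apply/eqP/(inj p).
by rewrite tE t0 scale0r /dmap linear0.
Qed.

Theorem proposition5p2 (R : realType) (n : nat)
  (Mt : manifold R n.+1) (M : manifold R n) (iota : M -> Mt)
  (gt : Mt -> 'rV[R]_n.+1 -> 'rV[R]_n.+1 -> R)
  (nablat nablats :
     Mt -> 'rV[R]_n.+1 -> (Mt -> 'rV[R]_n.+1) -> 'rV[R]_n.+1)
  (F Fs : Mt -> 'rV[R]_n.+1 -> 'rV[R]_n.+1)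
  (N : M -> 'rV[R]_n.+1)
  (xi xis : M -> 'rV[R]_n) (phi phis : M -> 'rV[R]_n -> 'rV[R]_n)
  (eta etas : M -> 'rV[R]_n -> R)
  (nabla nablas : M -> 'rV[R]_n -> (M -> 'rV[R]_n) -> 'rV[R]_n)
  (A As : M -> 'rV[R]_n -> 'rV[R]_n) (kappa : M -> 'rV[R]_n -> R)
  (hMt : locally_product_like_statistical_manifold gt nablat F Fs)
  (hdual : dual_connection gt nablat nablats)
  (hiota : immersion iota)
  (hN : unit_normal iota gt N)
  (htang : tangential iota F Fs N xi xis phi phis eta etas)
  (hgw : gauss_weingarten iota gt nablat nablats N nabla nablas A As kappa) :
  forall X Y : M -> 'rV[R]_n, smooth_field X -> smooth_field Y ->
  (forall p : M, cov_tensor11 nabla phi p (X p) Y =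
     induced_metric iota gt p (As p (X p)) (Y p) *: xi p
     + etas p (Y p) *: A p (X p)) /\
  (forall p : M, cov_tensor11 nablas phis p (X p) Y =
     induced_metric iota gt p (A p (X p)) (Y p) *: xis p
     + eta p (Y p) *: As p (X p)).
Proof.
move=> X Y Xs Ys.
have parFs p v Z : smooth_field_at Z p -> cov_tensor11 nablats Fs p v Z = 0.
  exact: dual_parallel hMt hdual.
have [[met conn _ _] TF TFs _ par _] := hMt.
split=> p.
- apply: (gauss_weingarten_tensor (N := N) (nablat := nablat) (F := F)
    (kappa := kappa p (X p))
    (h := induced_metric iota gt p (As p (X p))) met hiota hN conn TF).
  + by move=> w Z; exact: par.
  + exact: tang_phi htang.
  + exact: tang_etas htang.
  + exact: tang_FN htang p.
  + exact: tang_FX htang.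
  + by move=> Z; exact: (gw_gauss hgw (X p)).
  + exact: gw_weingarten hgw p (X p).
  + exact: Ys.
(* The dual formulas have the same shape with [A] and [As] exchanged and [kappa] negated; [Fs] is
   parallel by [parFs]. *)
- apply: (gauss_weingarten_tensor (N := N) (nablat := nablats) (F := Fs)
    (kappa := - kappa p (X p))
    (h := induced_metric iota gt p (A p (X p))) met hiota hN
    (dual_conn hdual) TFs).
  + by move=> w Z; exact: parFs.
  + exact: tang_phis htang.
  + exact: tang_eta htang.
  + exact: tang_FsN htang p.
  + exact: tang_FsX htang.
  + by move=> Z; exact: (gw_gauss_dual hgw (X p)).
  + by rewrite scaleNr; exact: gw_weingarten_dual hgw p (X p).
  + exact: Ys.
Qed.
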